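(* There exist absolute constants $0<C_1\le C_2$ such that the following holds. For all integers $k\ge 2$, $r\ge 1$ and $n\ge k(10r)^{9r}/2$ with $k\mid n$, there exists a real number $c'$ with $C_1\, r^{-9}k^{1/r-1}\le c'\le C_2\, r^{-9}k^{1/r-1}$ such that $$\mathrm{LCS}(r+2,B_k^n)\ \ge\ \frac{n}{k}+c'\,n^{1-\frac1r}.$$
   Context: $[k]=\{1,2,\ldots,k\}$, and $[k]^n$ is the set of all words (finite sequences of symbols) of length $n$ over $[k]$. A word $w\in[k]^n$ is balanced if it contains the same number of occurrences of $i$ as of $j$ for all $i,j\in[k]$ (so each letter occurs exactly $n/k$ times); $B_k^n$ is the set of all balanced words in $[k]^n$. A subsequence of a word $w$ is any word obtained from $w$ by deleting zero or more symbols (not necessarily consecutive ones). A common subsequence of $w$ and $w'$ is a word that is a subsequence of both; $\mathrm{LCS}(w,w')$ denotes the length of a longest common subsequence of $w$ and $w'$. For a finite multiset $\mathcal{W}$ of words, $\mathrm{LCS}(\mathcal{W})=\max \mathrm{LCS}(w,w')$, the maximum being over all pairs $\{w,w'\}$ in $\mathcal{W}$; that is, for $\mathcal{W}=(w^{(1)},\ldots,w^{(t)})$ with repetitions allowed, $\mathrm{LCS}(\mathcal{W})=\max_{1\le i<j\le t}\mathrm{LCS}(w^{(i)},w^{(j)})$. For an integer $t\ge2$ and a family $\mathcal{F}$ of words, $\mathrm{LCS}(t,\mathcal{F})=\min_{\mathcal{W}\in\mathcal{F}^t}\mathrm{LCS}(\mathcal{W})$. *)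

(* Defs.v *)
From mathcomp Require Import all_boot.

Set Implicit Arguments.
Unset Strict Implicit.
Unset Printing Implicit Defensive.

Definition balanced (k n : nat) (w : n.-tuple 'I_k) : bool :=
  [forall i : 'I_k, forall j : 'I_k, count_mem i w == count_mem j w].

Definition balanced_words (k n : nat) : {set n.-tuple 'I_k} :=
  [set w | balanced w].

(* [subseq] allows non-contiguous subsequences.  A common subsequence of w and
   w' is no longer than w, so bounding l by [size w] loses nothing; l = 0 is
   always admissible. *)
Definition lcs (T : finType) (w w' : seq T) : nat :=
  \max_(l < (size w).+1 |
          [exists s : l.-tuple T, subseq s w && subseq s w']) l.

(* A multiset of t words is presented as a family indexed by 'I_t; repetitions
   are allowed, so the two words of a pair may coincide. *)
Definition lcs_family (T : finType) (t n : nat)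
    (W : {ffun 'I_t -> n.-tuple T}) : nat :=
  \max_(i < t) \max_(j < t | i < j) lcs (W i) (W j).

(* [lcs_family W <= n] for words of length n, so the default value n of the
   iterated minimum does not affect the result when F is non-empty. *)
Definition min_lcs (T : finType) (t n : nat) (F : {set n.-tuple T}) : nat :=
  \big[minn/n]_(W : {ffun 'I_t -> n.-tuple T} | W \in ffun_on (mem F))
    lcs_family W.

(* Main.v *)
Require Import Defs.
From mathcomp Require Import all_boot all_order all_algebra.
From mathcomp Require Import reals exp.
From mathcomp Require Import zify.

Set Implicit Arguments.
Unset Strict Implicit.
Unset Printing Implicit Defensive.

(* Two letters suffice, so consider boolean words with m zeros ([false]) and m
    ones ([true]).  Index a position by the number x of zeros before it, and let
    its height be the number of ones before it minus x.

    Matching zeros x of one word with zeros x + s of another gives m - s letters.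
    If, after these zeros, b consecutive zeros are accompanied in both words by
    at least (1 + 1/h) b - 1 ones (a "rise" of length b), then matching the ones
    of that window instead of its zeros gains b / h letters.

    If two words are both high, or both low, at the same x, they have a long
    common subsequence at once.  Hence at every x at least r of the r + 2 words
    are at a small height.  By a rising sun argument, for almost all such x a
    rise of some length b < D^(r-1) starts at x.  The r lengths lie in the r - 1
    scales [D^k, D^(k+1)), so two words rise at the same scale.  A rise contains
    rises (of half the slope) of every much smaller length; so near x there are
    many pairs of places where both words rise with a common length, and for a
    suitable shift s a proportion of order 1/D of all x is good.  The gain is of
    order m / D up to powers of r, where D is of order m^(1/r). *)

(** * Common subsequences of boolean words; two high or two low words *)

Definition common (T : eqType) (u v : seq T) (l : nat) :=
  exists s, [/\ subseq s u, subseq s v & l <= size s].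

(* The suffix starting at zero number x (counted from 0), empty if there is
   none; [ones_before u x] is then the total number of ones. *)
Fixpoint zsuffix (u : seq bool) (x : nat) : seq bool :=
  match u with
  | [::] => [::]
  | true :: u' => zsuffix u' x
  | false :: u' => if x is x'.+1 then zsuffix u' x' else u
  end.

Fixpoint ones_before (u : seq bool) (x : nat) : nat :=
  match u with
  | [::] => 0
  | true :: u' => (ones_before u' x).+1
  | false :: u' => if x is x'.+1 then ones_before u' x' else 0
  end.

Lemma commonC (T : eqType) (u v : seq T) l : common u v l -> common v u l.
Proof. by case=> s [su sv ls]; exists s. Qed.

Lemma subseq_nseq_count (T : eqType) (c : T) (u : seq T) l :
  l <= count_mem c u -> subseq (nseq l c) u.
Proof.
elim: u l => [|a u IHu] [|l] //=.
by rewrite (eq_sym c); case: (a == c) => le_l; [exact: IHu | exact: IHu l.+1 _].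
Qed.

Lemma zsuffix_subseq u x : subseq (zsuffix u x) u.
Proof.
elim: u x => [|[] u IHu] [|x] //=.
- exact: subseq_trans (IHu 0) (subseq_cons _ _).
- exact: subseq_trans (IHu x.+1) (subseq_cons _ _).
- exact: subseq_trans (IHu x) (subseq_cons _ _).
Qed.

Lemma ones_before_le_count u x : ones_before u x <= count_mem true u.
Proof. by elim: u x => [|[] u IHu] [|x] //=; rewrite ?ltnS ?IHu. Qed.

Lemma count_zsuffix u x :
  count_mem true (zsuffix u x) + ones_before u x = count_mem true u.
Proof.
by elim: u x => [|[] u IHu] [|x] //=; rewrite ?addnS ?IHu ?addn0 ?add0n //= add0n.
Qed.

Lemma ones_before_mono u x y : x <= y -> ones_before u x <= ones_before u y.
Proof. by elim: u x y => [|[] u IHu] [|x] [|y] //= le_xy; rewrite ?ltnS IHu. Qed.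

Lemma ones_before_big u x :
  count_mem false u <= x -> ones_before u x = count_mem true u.
Proof. by elim: u x => [|[] u IHu] [|x] //= le; rewrite ?add0n IHu. Qed.

Lemma ones_zsuffix_subseq u x :
  subseq (nseq (ones_before u x) true ++ zsuffix u x) u.
Proof.
elim: u x => [|[] u IHu] x //; first exact: IHu.
case: x => [|x]; first exact: subseq_refl.
exact: subseq_trans (IHu x) (subseq_cons _ _).
Qed.

Lemma zeros_zsuffix_subseq u x :
  x < count_mem false u -> subseq (nseq x.+1 false ++ behead (zsuffix u x)) u.
Proof.
elim: u x => [|[] u IHu] // x lt_x.
case: x lt_x => [|x] lt_x; first exact: subseq_refl.
exact: (IHu x lt_x).
Qed.

Lemma zsuffix_step u x b :
  x < count_mem false u -> 0 < b ->
  subseq (false :: nseq (ones_before u (x + b) - ones_before u x) true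
            ++ zsuffix u (x + b)) (zsuffix u x).
Proof.
elim: u x => [|[] u IHu] // x lt_x b_gt0.
case: x lt_x => [|x] lt_x; last exact: (IHu x lt_x b_gt0).
case: b b_gt0 {IHu} => // b _; rewrite add0n subn0 /=.
exact: ones_zsuffix_subseq.
Qed.

Lemma count_false_zsuffix u x :
  count_mem false (zsuffix u x) = count_mem false u - x.
Proof.
elim: u x => [|[] u IHu] [|x] //=; rewrite ?add0n ?IHu ?subn0 //.
Qed.

Lemma zsuffix_head u x :
  x < count_mem false u -> zsuffix u x = false :: behead (zsuffix u x).
Proof. by elim: u x => [|[] u IHu] [|x] //= lt; apply: IHu. Qed.

(** Take [x + g] of the ones before zero [x], then the [m - x] zeros from zero [x] on. *)
Lemma common_high u v m x g :
    count_mem false u = m -> count_mem false v = m -> x <= m ->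
    x + g <= ones_before u x -> x + g <= ones_before v x ->
  common u v (m + g).
Proof.
move=> mu mv le_xm gu gv; exists (nseq (x + g) true ++ nseq (m - x) false).
have sub w : count_mem false w = m -> x + g <= ones_before w x ->
    subseq (nseq (x + g) true ++ nseq (m - x) false) w.
  move=> mw gw; apply: subseq_trans (ones_zsuffix_subseq w x).
  apply: cat_subseq; apply: subseq_nseq_count; last by rewrite count_false_zsuffix mw.
  by rewrite count_nseq /= mul1n.
by split; rewrite ?sub // size_cat !size_nseq; lia.
Qed.

(** Take the [x.+1] zeros up to and including zero [x], then ones: since few ones come before zero
    [x], at least [m + g - x.+1] of them come after it. *)
Lemma common_low u v m x g :
    count_mem false u = m -> count_mem false v = m ->
    count_mem true u = m -> count_mem true v = m -> x < m ->
    ones_before u x + g <= x.+1 -> ones_before v x + g <= x.+1 ->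
  common u v (m + g).
Proof.
move=> mu mv nu nv lt_xm gu gv.
exists (nseq x.+1 false ++ nseq (m + g - x.+1) true).
have sub w : count_mem false w = m -> count_mem true w = m ->
    ones_before w x + g <= x.+1 ->
    subseq (nseq x.+1 false ++ nseq (m + g - x.+1) true) w.
  move=> mw nw gw; have lt_xw : x < count_mem false w by rewrite mw.
  apply: subseq_trans (zeros_zsuffix_subseq lt_xw).
  apply: cat_subseq; first exact: subseq_refl.
  apply: subseq_nseq_count.
  by have := count_zsuffix w x; rewrite zsuffix_head //= add0n nw; lia.
by split; rewrite ?sub // size_cat !size_nseq; lia.
Qed.

(** * Gain of a shifted matching from joint rises *)

Lemma sum_bool_le (P : pred nat) p q : \sum_(p <= x < q) P x <= q - p.
Proof.
rewrite -[leqRHS]muln1 -sum_nat_const_nat.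
by apply: leq_sum => x _; case: (P x).
Qed.

(* The "+ 1" on the right accounts for zero x itself, which is always matched:
   only b - 1 zeros are given up. *)
Definition rises (h : nat) (Y : nat -> nat) (x b : nat) :=
  (0 < b) && (h * Y x + h.+1 * b <= h * (Y (x + b)).+1).

Definition joint_rise (h m : nat) (Y Y' : nat -> nat) (x y : nat) :=
  has (fun b => rises h Y x b && rises h Y' y b) (iota 1 m).

(** Greedy matching, left to right. At a joint rise of length [b], zero [x] is matched, then [d]
    ones, and the matching resumes at zero [x + b]; otherwise only zero [x] is matched. The rise
    gives [h * d.+1 >= h * b + b]: the first term pays for the [b] zeros passed, the second for the
    at most [b] joint rises starting among them. *)
Lemma common_shift_suffix u v h m s x :
    0 < h -> count_mem false u = m -> count_mem false v = m ->
  exists t, [/\ subseq t (zsuffix u x), subseq t (zsuffix v (x + s)) &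
    h * (m - (x + s)) +
      \sum_(x <= y < m - s)
        joint_rise h m (ones_before u) (ones_before v) y (y + s) <= h * size t].
Proof.
move=> h_gt0 mu mv; set J := joint_rise _ _ _ _.
have [n] := ubnP (m - (x + s)); elim: n x => // n IHn x lt_n.
have [le_m | lt_m] := leqP m (x + s).
  exists [::]; split; rewrite ?sub0seq //= big_geq; last lia.
  by rewrite (eqP (_ : m - (x + s) == 0)) //; lia.
have step b d : 0 < b -> d <= ones_before u (x + b) - ones_before u x ->
    d <= ones_before v (x + s + b) - ones_before v (x + s) -> 
    exists t, [/\ subseq (false :: nseq d true ++ t) (zsuffix u x),
      subseq (false :: nseq d true ++ t) (zsuffix v (x + s)) &
      h * (m - (x + b + s)) + \sum_(x + b <= y < m - s) J y (y + s)
        <= h * size t].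
  move=> b_gt0 du dv; have [|t [tu tv st]] := IHn (x + b); first lia.
  have sub e w : d <= e -> subseq t w ->
      subseq (false :: nseq d true ++ t) (false :: nseq e true ++ w).
    move=> le_de tw; rewrite /=; apply: cat_subseq => //.
    by apply: subseq_nseq_count; rewrite count_nseq /= mul1n.
  exists t; split=> //.
    by apply: subseq_trans (zsuffix_step _ b_gt0); [exact: sub | lia].
  apply: subseq_trans (zsuffix_step _ b_gt0); last lia.
  by apply: sub; rewrite // addnAC.
have split_sum b : 0 < b -> \sum_(x <= y < m - s) J y (y + s) <=
    b + \sum_(x + b <= y < m - s) J y (y + s).
  move=> b_gt0; have [le_b | lt_b] := leqP (x + b) (m - s).
    rewrite (@big_cat_nat _ _ _ (x + b)) //= ?leq_addr // leq_add2r.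
    by apply: leq_trans (sum_bool_le _ _ _) _; rewrite addKn.
  by apply: leq_trans (sum_bool_le _ _ _) _; lia.
case Jx: (J x (x + s)).
  have /hasP[b _ /andP[/andP[b_gt0 ru] /andP[_ rv]]] := Jx.
  pose d := minn (ones_before u (x + b) - ones_before u x)
                 (ones_before v (x + s + b) - ones_before v (x + s)).
  have [//| | |t [tu tv st]] := step b d; try by rewrite /d; lia.
  exists (false :: nseq d true ++ t); split=> //=.
  have := split_sum b b_gt0; rewrite size_cat size_nseq.
  have : h.+1 * b <= h * d.+1 by rewrite /d; nia.
  have : h * (m - (x + s)) <= h * (m - (x + b + s)) + h * b.
    by rewrite -mulnDr leq_mul2l; lia.
  lia.
have [//|//|//|t [tu tv st]] := step 1 0.
exists (false :: t); split=> //=.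
have -> : \sum_(x <= y < m - s) J y (y + s) = \sum_(x + 1 <= y < m - s) J y (y + s).
  by rewrite big_ltn ?Jx ?add0n ?addn1 //; lia.
have : h * (m - (x + s)) <= h * (m - (x + 1 + s)) + h * 1.
  by rewrite -mulnDr leq_mul2l; lia.
lia.
Qed.

Lemma rises_lt h u x b : rises h (ones_before u) x b -> x < count_mem false u.
Proof.
move=> /andP[b_gt0]; rewrite ltnNge; apply: contraL => le_x.
by rewrite !ones_before_big //; [nia | lia].
Qed.

Lemma common_shift u v h m s :
    0 < h -> count_mem false u = m -> count_mem false v = m -> s <= m ->
  exists2 l, common u v l & h * (m - s) +
      \sum_(x < m) joint_rise h m (ones_before u) (ones_before v) x (x + s)
       <= h * l.
Proof.
move=> h_gt0 mu mv le_sm; pose J := joint_rise h m (ones_before u) (ones_before v).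
have [t [tu tv st]] := common_shift_suffix s 0 h_gt0 mu mv.
exists (size t).
  exists t; split=> //; [exact: subseq_trans tu (zsuffix_subseq _ _) |].
  exact: subseq_trans tv (zsuffix_subseq _ _).
apply: leq_trans st; rewrite add0n leq_add2l.
rewrite -(big_mkord xpredT (fun x => J x (x + s) : nat)).
rewrite (@big_cat_nat _ _ _ (m - s)) ?leq_subr //= -[leqRHS]addn0 leq_add2l.
(* For [x >= m - s] the word [v] has no zero [x + s], so no rise starts there. *)
rewrite big_nat_cond big1 // => x /andP[/andP[le_x _] _].
apply/eqP; rewrite eqb0; apply/hasP => -[b _ /andP[_ /rises_lt]]; lia.
Qed.

(** * Rising sun argument: few stagnant points *)

(** If [a] and [c] are consecutive points of the chain, the failed rise of length [c - a < M] says
    [h * (Y c).+1 < h * Y a + h.+1 * (c - a)]; these inequalities telescope. *)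
Lemma nonrising_chain h (Y : nat -> nat) M a s :
    path ltn a s -> all (fun x => x < a + M) s ->
    (forall x b, x \in a :: s -> 0 < b < M -> ~~ rises h Y x b) ->
  h * (Y (last a s) + size s) + h.+1 * a <= h * Y a + h.+1 * last a s.
Proof.
elim: s a => [|c s IHs] a /= => [_ _ _|]; first by rewrite addn0.
case/andP=> lt_ac pc /andP[lt_cM sM] nr.
have {}IHs := IHs c pc.
have : ~~ rises h Y a (c - a) by apply: nr; rewrite ?mem_head //; lia.
rewrite /rises subn_gt0 lt_ac subnKC ?(ltnW lt_ac) //= -ltnNge => lt_h.
have : h * (Y (last c s) + size s) + h.+1 * c <= h * Y c + h.+1 * last c s.
  apply: IHs => [|x b xs]; last by apply: nr; rewrite inE xs orbT.
  by apply: sub_all sM => x /= lt_x; apply: ltn_trans lt_x _; rewrite ltn_add2r.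
have : h.+1 * c = h.+1 * (c - a) + h.+1 * a by rewrite -mulnDr subnK // ltnW.
by move: lt_h; rewrite addnS !mulnS; lia.
Qed.

(** The negations of the two conjuncts are the height hypotheses of [common_high] and [common_low],
    whence the asymmetric [x.+1]. *)
Definition confined (g : nat) (Y : nat -> nat) (x : nat) :=
  (Y x < x + g) && (x.+1 < Y x + g).

(* A window of length h * g contains few stagnant points: from each of them to
   the next the height drops by 1 up to slope 1/h, while over the whole window
   it varies by less than 2 * g. *)
Definition stagnant (h g : nat) (Y : nat -> nat) (x : nat) :=
  confined g Y x && all (fun b => ~~ rises h Y x b) (iota 1 (h * g).-1).

Lemma count_stagnant_window h g Y x0 :
  0 < h -> count (stagnant h g Y) (iota x0 (h * g)) <= 3 * g.
Proof.
move=> h_gt0; rewrite -size_filter.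
have : sorted ltn [seq x <- iota x0 (h * g) | stagnant h g Y x].
  exact: sorted_filter ltn_trans _ _ (iota_ltn_sorted _ _).
case def_s: [seq _ <- _ | _] => [|a s] //= pa.
have in_s x : x \in a :: s -> stagnant h g Y x && (x0 <= x < x0 + h * g).
  by rewrite -def_s mem_filter mem_iota.
have /andP[/andP[/andP[a_hi _] _] /andP[le_a _]] := in_s a (mem_head _ _).
have /andP[/andP[/andP[_ l_lo] _] /andP[_ lt_l]] := in_s _ (mem_last a s).
have : h * (Y (last a s) + size s) + h.+1 * a <= h * Y a + h.+1 * last a s.
  apply: (@nonrising_chain h Y (h * g)) => //.
    apply/allP=> x xs; have := in_s x; rewrite inE xs orbT => /(_ isT); lia.
  move=> x b /in_s /andP[/andP[_ /allP nr] _] b_int; apply: nr.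
  by rewrite mem_iota; lia.
(* The heights at [a] and [l] differ by less than [2 * g], and the slope [1/h] over a distance below
   [h * g] contributes less than [g]: [3 * g] in total. *)
set l := last a s in l_lo lt_l *; nia.
Qed.

(** Since [h * g <= m], at most [2 * m / (h * g)] windows of length [h * g] cover all positions. *)
Lemma count_stagnant h g Y m :
  0 < h -> 0 < g -> h * g <= m ->
  h * count (stagnant h g Y) (iota 0 m) <= 6 * m.
Proof.
move=> h_gt0 g_gt0 le_m; set M := h * g.
have M_gt0 : 0 < M by rewrite muln_gt0 h_gt0.
have count_mul q : count (stagnant h g Y) (iota 0 (q * M)) <= q * (3 * g).
  elim: q => [|q IHq] //.
  rewrite (mulSnr q M) (mulSnr q (3 * g)) iotaD count_cat leq_add //.
  exact: count_stagnant_window.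
have le_q : m <= (m %/ M).+1 * M by rewrite ltnW // ltn_ceil.
have le_c : count (stagnant h g Y) (iota 0 m) <= (m %/ M).+1 * (3 * g).
  apply: leq_trans (count_mul _); rewrite -(subnKC le_q) iotaD count_cat.
  exact: leq_addr.
have := leq_trunc_div m M; rewrite /M in le_c *; nia.
Qed.

(** * Rises inside rises *)

(* Otherwise the windows of length b starting at a - d, a - d + b, ... would
   cover the rise from a without any of them rising. *)
Lemma subrise h Y a B b d :
    1 < h -> {homo Y : x y / x <= y} -> rises h Y a B ->
    0 < b <= a -> 5 * h * b <= B -> d < b ->
  exists2 l, rises (2 * h) Y (a - d + l * b) b & a - d + l * b <= a + B.
Proof.
move=> h_gt1 Ymono /andP[B_gt0 rB] /andP[b_gt0 le_ba] le_bB lt_db.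
pose n := ((B + d) %/ b).+1.
have n_hi : n * b <= B + d + b by rewrite mulSn addnC leq_add2r leq_trunc_div.
have n_lo : B + d < n * b by rewrite ltn_ceil.
have [/hasP[l ln rl] | /hasPn nr] :=
    boolP (has (fun l => rises (2 * h) Y (a - d + l * b) b) (iota 0 n)).
  exists l => //; move: ln; rewrite mem_iota add0n ltnS leq_divRL //; lia.
have sumY i : i <= n ->
    2 * h * (Y (a - d + i * b) + i) <= 2 * h * Y (a - d) + i * ((2 * h).+1 * b).
  elim: i => [|i IHi] lt_in; first by rewrite !mul0n !addn0.
  have := nr i; rewrite mem_iota lt_in => /(_ isT).
  rewrite /rises b_gt0 /= -ltnNge -addnA -mulSnr.
  have := IHi (ltnW lt_in); nia.
(* Halving the slope leaves a surplus of [B] in favour of the long rise. The windows overhang it by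
   at most [d + b < 2 * b], which costs less than [(2 * h).+1 * (2 * b) <= 5 * h * b <= B]: a
   contradiction. *)
have := sumY n (leqnn n).
have : Y (a - d) <= Y a by apply: Ymono; lia.
have : Y (a + B) <= Y (a - d + n * b) by apply: Ymono; lia.
have : 0 < n by [].
move: n_hi; clearbody n => n_hi n_gt0 YB Ya sumn.
have : 2 * h * Y (a + B) <= 2 * h * Y (a - d + n * b) by rewrite leq_mul2l YB orbT.
have : 2 * h * Y (a - d) <= 2 * h * Y a by rewrite leq_mul2l Ya orbT.
have : n * ((2 * h).+1 * b) <= (2 * h).+1 * (B + d + b) by rewrite mulnCA leq_mul2l n_hi.
have : h * n >= h by rewrite leq_pmulr.
have : h * d <= h * b by rewrite leq_mul2l ltnW ?orbT.
have : 2 * b <= h * b by rewrite leq_mul2r h_gt1 orbT.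
lia.
Qed.

Lemma card_subrise h Y m a B b :
    1 < h -> {homo Y : x y / x <= y} ->
    (forall x c, rises (2 * h) Y x c -> x < m) ->
    rises h Y a B -> 0 < b <= a -> (b == 1) || (5 * h * b <= B) ->
  b <= #|[set x : 'I_m | rises (2 * h) Y x b && (a <= x + b) && (x <= a + B)]|.
Proof.
move=> h_gt1 Ymono Ym raB b_int.
case: eqP => [-> _ | _ /= le_bB].
  (* For [b = 1], any step where [Y] grows is a rise. Such a step exists in the long rise, however
     short: otherwise [Y] would be constant there. *)
  rewrite card_gt0; apply/set0Pn.
  have [/hasP[x]|/hasPn flat] := boolP (has (fun x => Y x < Y x.+1) (iota a B)).
    rewrite mem_iota => x_int ltY.
    have rx : rises (2 * h) Y x 1 by rewrite /rises addn1; nia.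
    by exists (Ordinal (Ym _ _ rx)); rewrite inE rx /=; lia.
  have cst i : i <= B -> Y (a + i) <= Y a.
    elim: i => [|i IHi] lt_i; first by rewrite addn0.
    have := flat (a + i); rewrite mem_iota => /(_ _)/negP.
    have := IHi (ltnW lt_i); rewrite addnS; lia.
  by case/andP: raB => B_gt0; have := cst B (leqnn B); nia.
(* One rise of length b starts in each residue class modulo b. *)
have /fin_all_exists[f f_spec] : forall d : 'I_b, exists x : 'I_m,
    [/\ rises (2 * h) Y x b, a <= x + b, x <= a + B & x + d = a %[mod b]].
  move=> d; have [l rl le_l] := subrise h_gt1 Ymono raB b_int le_bB (ltn_ord d).
  exists (Ordinal (Ym _ _ rl)); split=> //=; first by have := ltn_ord d; lia.
  rewrite addnAC subnK ?modnMDl ?[a + _]addnC ?modnMDl //.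
  by have := ltn_ord d; lia.
have f_inj : injective f.
  move=> d e eq_f; have [_ _ _ fd] := f_spec d; have [_ _ _ fe] := f_spec e.
  move: fd; rewrite -fe -eq_f => /eqP; rewrite eqn_modDl !modn_small ?ltn_ord //.
  by move/eqP/val_inj.
rewrite -[b in b <= _]card_ord -(card_imset _ f_inj).
apply/subset_leq_card/subsetP=> _ /imsetP[d _ ->].
by have [rf lo hi _] := f_spec d; rewrite inE rf lo hi.
Qed.

(** * Covering argument *)

Definition near (m : nat) (b : 'I_m -> nat) (a x : 'I_m) :=
  (a <= x + b a) && (x <= a + b a).

(* Vitali's argument: the point a of A with the largest b a accounts for all
   points of A within distance 2 * b a. *)
Lemma vitali_sum (m c : nat) (A : {set 'I_m}) (b w : 'I_m -> nat) :
    (forall a, a \in A -> 0 < b a) ->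
    (forall a, a \in A -> c * b a <= \sum_(x | near b a x) w x) ->
  c * #|A| <= 5 * \sum_(x | [exists a in A, near b a x]) w x.
Proof.
have [n] := ubnP #|A|; elim: n A => // n IHn A ltA b_gt0 wA.
have [->|/set0Pn[a0 a0A]] := eqVneq A set0; first by rewrite cards0 muln0.
have [a aA a_max] : exists2 a, a \in A & forall x, x \in A -> b x <= b a.
  by case: (arg_maxnP b a0A) => a aA a_max; exists a.
pose C := [set x : 'I_m | (a <= x + 2 * b a) && (x <= a + 2 * b a)].
have cardC : #|C| <= 5 * b a.
  have <- : #|[set: 'I_(5 * b a)]| = 5 * b a by rewrite cardsT card_ord.
  have ba := b_gt0 a aA.
  have lt_f (x : 'I_m) : x \in C -> x + 2 * b a - a < 5 * b a.
    by rewrite inE; lia.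
  have pos : 0 < 5 * b a by lia.
  pose f (x : 'I_m) : 'I_(5 * b a) := insubd (Ordinal pos) (x + 2 * b a - a).
  rewrite -(@card_in_imset _ _ f C) ?subset_leq_card ?subsetT // => x y xC yC.
  move/(congr1 val); rewrite !val_insubd !lt_f // => eq_xy.
  by apply: val_inj => /=; move: xC yC; rewrite !inE; lia.
have ltA2 : #|A :\: C| < n.
  move: ltA; rewrite ltnS; apply: leq_trans; apply: proper_card.
  apply/properP; split; first exact: subsetDl.
  by exists a; rewrite // !inE; lia.
have IH : c * #|A :\: C| <= 5 * \sum_(x | [exists a in A :\: C, near b a x]) w x.
  by apply: IHn => // x; rewrite inE => /andP[_ xA]; [exact: b_gt0 | exact: wA].
have le_card : #|A| <= #|A :\: C| + #|C|.
  by rewrite -(cardsID C A) addnC leq_add2l subset_leq_card ?subsetIr.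
(* A point of [A] outside [C] is further than [2 * b a] from [a] and has radius at most [b a], so
   the two neighbourhoods are disjoint and their weights add. *)
have sum_split : \sum_(x | near b a x) w x +
    \sum_(x | [exists a in A :\: C, near b a x]) w x <=
    \sum_(x | [exists a in A, near b a x]) w x.
  rewrite [leqRHS](bigID (fun x => near b a x)) /= leq_add //.
    rewrite [leqRHS](eq_bigl (near b a)) // => x.
    apply/andP/idP => [[]//|ax]; split=> //.
    by apply/existsP; exists a; rewrite aA.
  rewrite [leqLHS]big_mkcond [leqRHS]big_mkcond leq_sum // => x _.
  case: existsP => // -[y /andP[]]; rewrite !inE => /andP[yC yA] yx.
  have -> : [exists a0 in A, near b a0 x] by apply/existsP; exists y; rewrite yA.
  have -> //= : ~~ near b a x.
  by have := a_max y yA; move: yC yx; rewrite /near; lia.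
have := wA a aA; have : c * #|A| <= c * #|A :\: C| + c * (5 * b a).
  by rewrite -mulnDr leq_mul2l (leq_trans le_card) ?leq_add2l ?orbT.
lia.
Qed.

(** * Double counting of joint rises over shifts *)

Lemma joint_riseC h m Y Y' x y : joint_rise h m Y Y' x y = joint_rise h m Y' Y y x.
Proof. by apply: eq_has => b; rewrite andbC. Qed.

(** A pair is charged to the shift [s = |x - y|], written [(y - x) + (x - y)] with truncated
    subtraction; the two inner sums serve the two signs of [x - y]. *)
Lemma sum_by_shift (m U : nat) (J : rel nat) :
  \sum_(x < m) \sum_(y < m) (J x y && (x <= y + U) && (y <= x + U)) <=
  \sum_(s < U.+1) (\sum_(x < m) J x (x + s) + \sum_(y < m) J (y + s) y).
Proof.
have sum_eq (P : pred nat) (z : nat) : \sum_(y < m) ((y == z :> nat) && P y) <= P z.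
  have [lt_z|ge_z] := ltnP z m.
    rewrite (bigD1 (Ordinal lt_z)) //= eqxx big1 ?addn0 // => y.
    by rewrite -val_eqE /= => /negbTE->.
  by rewrite big1 // => y _; rewrite (_ : y == z :> nat = false) //; have := ltn_ord y; lia.
have le_sum : \sum_(x < m) \sum_(y < m) (J x y && (x <= y + U) && (y <= x + U)) <=
    \sum_(s < U.+1) \sum_(x < m) \sum_(y < m)
      (((y == x + s :> nat) && J x y) + ((x == y + s :> nat) && J x y)).
  rewrite [leqRHS]exchange_big; apply: leq_sum => x _.
  rewrite [leqRHS]exchange_big; apply: leq_sum => y _ /=.
  case Jxy: (J x y && _ && _) => //; move: Jxy => /andP[/andP[Jxy lo] hi].
  have lt_s : (y - x) + (x - y) < U.+1 by lia.
  rewrite (bigD1 (Ordinal lt_s)) //= Jxy !andbT; apply: leq_trans (leq_addr _ _).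
  have [le_xy|/ltnW le_yx] := leqP x y.
    have /eqP -> : (x + (y - x + (x - y)) == y)%N by lia.
    by rewrite eqxx.
  have /eqP -> : (y + (y - x + (x - y)) == x)%N by lia.
  by rewrite eqxx addn1.
apply: leq_trans le_sum _; apply: leq_sum => s _.
rewrite -[leqLHS]/(\sum_(x < m) _).
under eq_bigr do rewrite big_split.
rewrite big_split /= leq_add //.
  by apply: leq_sum => x _; apply: (sum_eq (J x)).
by rewrite exchange_big /=; apply: leq_sum => y _; apply: (sum_eq (J^~ y)).
Qed.

(** Near each [a] of [A] both functions have at least [t] rises of one common length [t], of order
    [b a / h]. This gives [t ^ 2] joint pairs near [a], so [100 * h ^ 2] times their number is at
    least [b a ^ 2 >= L * b a], as [vitali_sum] requires. *)
Lemma card_joint_rise h m L U (Y Y' : nat -> nat) (A : {set 'I_m})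
    (b b' : 'I_m -> nat) :
    1 < h -> {homo Y : x y / x <= y} -> {homo Y' : x y / x <= y} ->
    (forall x c, rises (2 * h) Y x c -> x < m /\ c <= m) ->
    (forall x c, rises (2 * h) Y' x c -> x < m) ->
    0 < L ->
    (forall a, a \in A -> [/\ U <= a, L <= b a <= b' a, b' a < U,
        rises h Y a (b a) & rises h Y' a (b' a)]) ->
  L * #|A| <= 500 * h ^ 2 * \sum_(x < m) \sum_(y < m)
    (joint_rise (2 * h) m Y Y' x y && (x <= y + 2 * U) && (y <= x + 2 * U)).
Proof.
move=> h_gt1 Ymono Ymono' Ym Ym' L_gt0 hA.
pose deg (x : 'I_m) := \sum_(y < m)
  (joint_rise (2 * h) m Y Y' x y && (x <= y + 2 * U) && (y <= x + 2 * U)).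
have le_vit : L * #|A| <=
    5 * \sum_(x | [exists a in A, near b a x]) (100 * h ^ 2 * deg x).
  apply: vitali_sum => a aA; have [le_Ua /andP[le_L le_bb] lt_bU ra ra'] := hA a aA.
    exact: leq_trans L_gt0 le_L.
  (* The length is taken from the shorter rise [b a], so that it suits both. The value 1 serves when
     [b a < 5 * h]; in all cases [b a <= 10 * h * t]. *)
  pose t := maxn 1 (b a %/ (5 * h)).
  have b_gt0 : 0 < b a := leq_trans L_gt0 le_L.
  have h5_gt0 : 0 < 5 * h by lia.
  have t_le : (t == 1) || (5 * h * t <= b a).
    rewrite /t; case: (b a %/ (5 * h)) (leq_trunc_div (b a) (5 * h)) => // q.
    by rewrite (maxn_idPr (ltn0Sn q)) [q.+1 * _]mulnC => ->; rewrite orbT.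
  have t_int : 0 < t <= a.
    rewrite /t leq_max /= geq_max; have := leq_div (b a) (5 * h); lia.
  have t_ge : b a <= 10 * h * t.
    have := ltn_ceil (b a) h5_gt0; rewrite /t.
    case: (b a %/ (5 * h)) => [|q] lt_b; first by rewrite (maxn_idPl _) //; lia.
    by rewrite (maxn_idPr _) //; nia.
  pose P := [set x : 'I_m | rises (2 * h) Y x t && (a <= x + t) && (x <= a + b a)].
  pose R := [set x : 'I_m | rises (2 * h) Y' x t && (a <= x + t) && (x <= a + b' a)].
  have cardP : t <= #|P| by apply: card_subrise => // x c /Ym[].
  have cardR : t <= #|R|.
    by apply: card_subrise => //; case/orP: t_le => [->//|le]; rewrite (leq_trans le) ?orbT.
  have t_leb : t <= b a.
    by rewrite /t geq_max b_gt0 leq_div.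
  have degP x : x \in P -> t <= deg x.
    rewrite inE => /andP[/andP[rx lo] hi]; apply: leq_trans cardR _.
    rewrite -sum1_card big_mkcond; apply: leq_sum => y _.
    case: ifP => //; rewrite inE => /andP[/andP[ry lo'] hi'].
    have -> : joint_rise (2 * h) m Y Y' x y.
      apply/hasP; exists t; last by rewrite rx ry.
      by rewrite mem_iota; have [_] := Ym _ _ rx; case/andP: t_int; lia.
    by rewrite lt0b; lia.
  have sumP : t * t <= \sum_(x | near b a x) deg x.
    apply: (@leq_trans (\sum_(x in P) t)).
      by rewrite sum_nat_const leq_mul2r cardP orbT.
    apply: (@leq_trans (\sum_(x in P) deg x)); first exact: leq_sum.
    rewrite [leqLHS]big_mkcond [leqRHS]big_mkcond; apply: leq_sum => x _.
    by case: ifP => //; rewrite inE /near => /andP[/andP[_ lo] hi]; case: ifP => //; lia.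
  rewrite -big_distrr /=; apply: (@leq_trans (100 * h ^ 2 * (t * t))); last first.
    by rewrite leq_mul2l sumP orbT.
  apply: (@leq_trans (b a * b a)); first by rewrite leq_mul2r le_L orbT.
  by apply: leq_trans (leq_mul t_ge t_ge) _; rewrite expnS expn1; lia.
apply: leq_trans le_vit _.
rewrite -big_distrr /= mulnA (_ : 5 * (100 * h ^ 2) = 500 * h ^ 2); last lia.
rewrite leq_mul2l; apply/orP; right.
by rewrite [leqRHS](bigID (fun x => [exists a in A, near b a x])) /= leq_addr.
Qed.

Lemma card_joint_rise_shift h m L U T (Y Y' : nat -> nat) (A : {set 'I_m})
    (b b' : 'I_m -> nat) :
    1 < h -> {homo Y : x y / x <= y} -> {homo Y' : x y / x <= y} ->
    (forall x c, rises (2 * h) Y x c -> x < m /\ c <= m) ->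
    (forall x c, rises (2 * h) Y' x c -> x < m) ->
    0 < L -> 0 < U ->
    (forall a, a \in A -> [/\ U <= a, L <= b a <= b' a, b' a < U,
        rises h Y a (b a) & rises h Y' a (b' a)]) ->
    (forall s, s <= 2 * U ->
       \sum_(x < m) joint_rise (2 * h) m Y Y' x (x + s) <= T) ->
    (forall s, s <= 2 * U ->
       \sum_(x < m) joint_rise (2 * h) m Y' Y x (x + s) <= T) ->
  L * #|A| <= 3000 * h ^ 2 * U * T.
Proof.
move=> h_gt1 Ym Ym' rY rY' L_gt0 U_gt0 hA sT sT'.
apply: leq_trans (card_joint_rise h_gt1 Ym Ym' rY rY' L_gt0 hA) _.
(* There are [2 * U + 1 <= 3 * U] shifts, each counted in both directions with at most [T] joint
   rises: this is the factor 6. *)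
rewrite (_ : 3000 * h ^ 2 * U * T = 500 * h ^ 2 * (6 * U * T)); last lia.
rewrite leq_mul2l; apply/orP; right.
apply: leq_trans (sum_by_shift _ _ (joint_rise (2 * h) m Y Y')) _.
apply: (@leq_trans (\sum_(s < (2 * U).+1) (T + T))).
  apply: leq_sum => s _; have s_le : s <= 2 * U by rewrite -ltnS.
  apply: leq_add; first exact: sT.
  by apply: leq_trans (sT' s s_le); apply: leq_sum => x _; rewrite joint_riseC.
by rewrite sum_nat_const card_ord; nia.
Qed.

Lemma ones_before_rises h u m x b :
    0 < h -> count_mem false u = m -> count_mem true u = m ->
  rises h (ones_before u) x b -> x < m /\ b <= m.
Proof.
move=> h_gt0 um tm rx; split; first by rewrite -um; exact: rises_lt rx.
case/andP: rx => b_gt0; have := ones_before_le_count u (x + b); rewrite tm; nia.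
Qed.

(** * Families of [K.+3] words, that is [r = K.+1 >= 2] *)

(** At most one word violates each conjunct of [confined]. *)
Lemma card_confined n g (Y : 'I_n.+2 -> nat -> nat) x :
    (forall i j, i != j -> ~~ ((x + g <= Y i x) && (x + g <= Y j x))) ->
    (forall i j, i != j -> ~~ ((Y i x + g <= x.+1) && (Y j x + g <= x.+1))) ->
  n <= #|[set i | confined g (Y i) x]|.
Proof.
move=> hi lo; pose H := [set i | x + g <= Y i x]; pose L := [set i | Y i x + g <= x.+1].
have le1 (B : {set 'I_n.+2}) : (forall i j, i \in B -> j \in B -> i = j) -> #|B| <= 1.
  move=> B1; have [->|/set0Pn[i iB]] := eqVneq B set0; first by rewrite cards0.
  by rewrite -(cards1 i) subset_leq_card //; apply/subsetP=> j jB; rewrite inE (B1 j i).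
have cH : #|H| <= 1.
  apply: le1 => i j; rewrite !inE => iH jH; apply/eqP/negPn/negP => /hi.
  by rewrite iH jH.
have cL : #|L| <= 1.
  apply: le1 => i j; rewrite !inE => iH jH; apply/eqP/negPn/negP => /lo.
  by rewrite iH jH.
have : #|~: [set i | confined g (Y i) x]| <= #|H :|: L|.
  apply/subset_leq_card/subsetP => i; rewrite !inE /confined; lia.
have := cardsC [set i | confined g (Y i) x]; rewrite card_ord.
have := leq_card_setU H L; case: (leq_card_setU H L) => le_U _; lia.
Qed.

Section Family.

Variables (K h D g m : nat) (u : 'I_K.+3 -> seq bool).
Hypotheses (K_gt0 : 0 < K) (D_gt1 : 1 < D) (def_h : h = 16 * K.+3).
Hypotheses (def_M : h * g = D ^ K).
Hypothesis (le_m : 36 * 1000 * K.+3 ^ 3 * h ^ 3 * D ^ K.+1 <= m).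
Hypotheses (um : forall i, count_mem false (u i) = m).
Hypotheses (tm : forall i, count_mem true (u i) = m).

Let Y i := ones_before (u i).
Let M := D ^ K.
(** Each length stands in [iota 0 M] at its own index, so [find] returns the least length of a rise
    at [x], or [M] if there is none below [M]. *)
Let first_rise i x := find (rises h (Y i) x) (iota 0 M).
(** Positions where words [i] and [j] first rise at the same scale [k], [i] being the shorter;
    [M <= x] leaves room on the left for the rises found inside. *)
Let A i j k := [set x : 'I_m | [&& M <= x, first_rise i x <= first_rise j x,
  D ^ k <= first_rise i x & first_rise j x < D ^ k.+1]].

Let h_gt1 : 1 < h. Proof. by rewrite def_h; lia. Qed.

Let M_gt0 : 0 < M. Proof. by rewrite expn_gt0 ltnW. Qed.

Let first_riseP i x : first_rise i x < M -> rises h (Y i) x (first_rise i x).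
Proof.
move=> lt_M; have := nth_find 0 (_ : has (rises h (Y i) x) (iota 0 M)).
by rewrite -/(first_rise i x) nth_iota // add0n; apply; rewrite has_find size_iota.
Qed.

Let confined_first_rise i x :
  confined g (Y i) x -> ~~ stagnant h g (Y i) x -> 0 < first_rise i x < M.
Proof.
rewrite /stagnant => -> /=; rewrite all_predC negbK def_M -/M => hasr.
have lt_M : first_rise i x < M.
  rewrite /first_rise -[X in _ < X](size_iota 0 M) -has_find.
  case/hasP: hasr => b; rewrite mem_iota => b_int rb.
  by apply/hasP; exists b; rewrite // mem_iota; lia.
by rewrite lt_M andbT; case/andP: (first_riseP lt_M).
Qed.

(** Pigeonhole: [K.+1] words have a first rise of length in [[1, D ^ K)], and [trunc_log] sorts
    these lengths into [K] scales. *)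
Let covered (x : 'I_m) :
    K.+1 <= #|[set i | confined g (Y i) x]| ->
    M <= x -> (forall i, ~~ stagnant h g (Y i) x) ->
  exists i j (k : 'I_K), i != j /\ x \in A i j k.
Proof.
set S := [set i | _] => cardS le_Mx nst.
have SP i : i \in S -> 0 < first_rise i x < M.
  by rewrite inE => /confined_first_rise; apply.
pose lev i := trunc_log D (first_rise i x).
have lev_lt i : i \in S -> lev i < K.
  move=> /SP/andP[r_gt0 r_lt]; rewrite -(ltn_exp2l _ _ D_gt1).
  by apply: leq_ltn_trans r_lt; rewrite /lev trunc_logP.
pose f i : 'I_K := insubd (Ordinal K_gt0) (lev i).
have [inj_f|] := boolP [forall i in S, forall j in S, (f i == f j) ==> (i == j)].
  have eq_card : #|f @: S| = #|S|.
    apply: card_in_imset => i j iS jS /eqP eq_f; apply/eqP.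
    by move/forall_inP/(_ i iS)/forall_inP/(_ j jS)/implyP: inj_f; apply.
  by have := subset_leq_card (subsetT (f @: S)); rewrite cardsT card_ord eq_card; lia.
rewrite negb_forall_in => /exists_inP[i iS]; rewrite negb_forall_in => /exists_inP[j jS].
rewrite negb_imply => /andP[/eqP eq_f neq_ij].
have eq_lev : lev i = lev j.
  by have := congr1 val eq_f; rewrite !val_insubd !lev_lt.
have inA a b : a \in S -> b \in S -> lev a = lev b ->
    first_rise a x <= first_rise b x -> x \in A a b (f a).
  move=> aS bS eq_ab le_ab; rewrite inE le_Mx le_ab val_insubd lev_lt //=.
  have /andP[ra _] := SP a aS; have /andP[rb _] := SP b bS.
  by rewrite {1}/lev trunc_logP //= eq_ab /lev trunc_log_ltn.
have [le_ij|/ltnW le_ji] := leqP (first_rise i x) (first_rise j x).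
  by exists i, j, (f i); rewrite inA.
by exists j, i, (f j); rewrite eq_sym inA.
Qed.

(** Two high words, two low words, or a shift with many joint rises each give the result. If none
    occurs, the positions below [M], the stagnant ones and the sets [A i j k] are too few to cover
    all [m] positions. *)
Lemma common_family : exists i j, i != j /\ common (u i) (u j) (m + g).
Proof.
have h_gt0 : 0 < h := ltnW h_gt1.
have le_gM : g <= M by rewrite /M -def_M leq_pmull.
have le_MD : M <= D ^ K.+1 by rewrite leq_exp2l.
have p_gt0 : 0 < K.+3 ^ 3 * h ^ 3 by rewrite muln_gt0 !expn_gt0 h_gt0.
have le_16 : 16 * M <= m.
  apply: leq_trans le_m; apply: (@leq_trans (36 * 1000 * D ^ K.+1)).
    exact: leq_mul.
  by rewrite leq_mul2r -[_ * _ * h ^ 3]mulnA leq_pmulr ?orbT.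
have [/existsP[i /existsP[j /existsP[x /and3P[ij xi xj]]]]|nhi] := boolP
    [exists i, exists j, exists x : 'I_m,
      [&& i != j, x + g <= Y i x & x + g <= Y j x]].
  by exists i, j; split=> //; apply: common_high xi xj => //; apply: ltnW.
have [/existsP[i /existsP[j /existsP[x /and3P[ij xi xj]]]]|nlo] := boolP
    [exists i, exists j, exists x : 'I_m,
      [&& i != j, Y i x + g <= x.+1 & Y j x + g <= x.+1]].
  by exists i, j; split=> //; apply: common_low xi xj.
pose c i j s := \sum_(x < m) joint_rise (2 * h) m (Y i) (Y j) x (x + s).
(* The threshold is [2 * h * (3 * M)]: a gain of [3 * M] letters at the halved slope, against a loss
   of [s <= 2 * M], leaves [M >= g]. *)
have [/existsP[i /existsP[j /existsP[s /andP[ij big]]]]|nsh] := boolP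
    [exists i, exists j, exists s : 'I_(2 * M).+1, (i != j) && (6 * h * M <= c i j s)].
  exists i, j; split=> //; have s_le : s <= 2 * M by rewrite -ltnS.
  have [||l [t [tu tv tl]] cl] := @common_shift (u i) (u j) (2 * h) m s _ (um i) (um j).
  - lia.
  - lia.
  exists t; split=> //; apply: leq_trans tl.
  rewrite -(leq_pmul2l (_ : 0 < 2 * h)); last lia.
  apply: leq_trans cl; apply: leq_trans (leq_add (leqnn _) big).
  have -> : 6 * h * M = 2 * h * (3 * M) by lia.
  by rewrite -mulnDr leq_mul2l; lia.
have small i j s : i != j -> s <= 2 * M -> c i j s <= 6 * h * M.
  move=> ij s_le; have s_lt : s < (2 * M).+1 by [].
  rewrite leqNgt; apply/negP => big; case/negP: nsh.
  by apply/existsP; exists i; apply/existsP; exists j; apply/existsP;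
    exists (Ordinal s_lt); rewrite ij ltnW.
(* Used with [L = D ^ k] and [U = D ^ k.+1]: after cancelling [L], the width of a scale costs one
   factor [D], whatever [k] is. *)
have cardA i j (k : 'I_K) : i != j -> #|A i j k| <= 18 * 1000 * h ^ 3 * D ^ K.+1.
  move=> ij; have le_kK : D ^ k.+1 <= M by rewrite leq_exp2l.
  have : D ^ k * #|A i j k| <= 3000 * h ^ 2 * D ^ k.+1 * (6 * h * M).
    apply: (@card_joint_rise_shift h m (D ^ k) (D ^ k.+1) (6 * h * M) (Y i) (Y j) _
      (first_rise i) (first_rise j)) => //; rewrite ?expn_gt0 ?(ltnW D_gt1) //.
    - by move=> x y; apply: ones_before_mono.
    - by move=> x y; apply: ones_before_mono.
    - by move=> x b; apply: ones_before_rises; rewrite ?muln_gt0.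
    - by move=> x b /ones_before_rises - /(_ m)[]; rewrite ?muln_gt0.
    - move=> a; rewrite inE => /and4P[Ma le_ij le_i lt_j].
      have lt_jM := leq_trans lt_j le_kK.
      split=> //; rewrite ?le_i //; first exact: leq_trans le_kK Ma.
        by apply: first_riseP; apply: leq_ltn_trans lt_jM.
      exact: first_riseP.
    - by move=> s s_le; apply: small => //; lia.
    - by move=> s s_le; apply: small; rewrite 1?eq_sym //; lia.
  have -> : 3000 * h ^ 2 * D ^ k.+1 * (6 * h * M) =
      D ^ k * (18 * 1000 * h ^ 3 * D ^ K.+1).
    by rewrite /M (expnS D k) (expnS D K) (expnS h 2); lia.
  by rewrite leq_pmul2l // expn_gt0 ltnW.
pose stag i := count (stagnant h g (Y i)) (iota 0 m).
have stag_le i : h * stag i <= 6 * m.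
  apply: count_stagnant => //; last by rewrite def_M; lia.
  by move: M_gt0; rewrite /M -def_M muln_gt0 => /andP[].
have stagE i : stag i = \sum_(x < m) stagnant h g (Y i) x.
  rewrite -(big_mkord xpredT (fun x => stagnant h g (Y i) x : nat)) /stag.
  by rewrite -sumn_count /index_iota subn0 sumnE big_map.
have cover : m <= \sum_(x < m) ((x < M) + \sum_i stagnant h g (Y i) x +
    \sum_i \sum_(j | i != j) \sum_(k < K) (x \in A i j k)).
  rewrite -[leqLHS]card_ord -sum1_card; apply: leq_sum => x _.
  have [//|le_Mx] := ltnP x M; rewrite add0n.
  have [/existsP[i st]|nst] := boolP [exists i, stagnant h g (Y i) x].
    by rewrite (bigD1 i) //= st.
  have [i [j [k [ij xA]]]] : exists i j (k : 'I_K), i != j /\ x \in A i j k.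
    apply: covered => // [|i]; last first.
      by apply/negP => st; case/negP: nst; apply/existsP; exists i.
    apply: card_confined => i j ij; apply/negP => /andP[xi xj].
      case/negP: nhi; apply/existsP; exists i; apply/existsP; exists j.
      by apply/existsP; exists x; rewrite ij xi xj.
    case/negP: nlo; apply/existsP; exists i; apply/existsP; exists j.
    by apply/existsP; exists x; rewrite ij xi xj.
  by rewrite addnC (bigD1 i) //= (bigD1 j) //= (bigD1 k) //= xA.
have sumM : \sum_(x < m) (x < M) <= M.
  rewrite -(big_mkord xpredT (fun x => (x < M) : nat)).
  rewrite (@big_cat_nat _ _ _ M) //=; last lia.
  rewrite [X in _ + X]big_nat_cond [X in _ + X]big1 => [|x]; last first.
    by rewrite [x < M]ltnNge => /andP[/andP[-> _] _].
  by rewrite addn0 (leq_trans (sum_bool_le _ _ _)) ?subn0.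
have sum_stag : 16 * \sum_(x < m) \sum_i stagnant h g (Y i) x <= 6 * m.
  rewrite exchange_big /= (eq_bigr stag) => [|i _]; last by rewrite stagE.
  rewrite -(leq_pmul2l (ltn0Sn K.+2)) mulnCA mulnA -def_h big_distrr /=.
  apply: (@leq_trans (\sum_(i < K.+3) 6 * m)); first by apply: leq_sum => i _.
  by rewrite sum_nat_const card_ord.
set B := 18 * 1000 * h ^ 3 * D ^ K.+1 in cardA.
have sumA : \sum_(x < m) \sum_i \sum_(j | i != j) \sum_(k < K) (x \in A i j k) <=
    K.+3 * (K.+3 * (K * B)).
  rewrite exchange_big -[X in X * _](card_ord K.+3) -sum_nat_const /=.
  apply: leq_sum => i _; rewrite exchange_big -[X in X * _](card_ord K.+3) -sum_nat_const.
  rewrite [leqLHS]big_mkcond; apply: leq_sum => j _; case: ifP => //= ij.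
  rewrite exchange_big -[X in X * _](card_ord K) -sum_nat_const /=.
  apply: leq_sum => k _; apply: leq_trans (cardA i j k ij).
  by rewrite -sum1_card [leqRHS]big_mkcond; apply: leq_sum => x _; case: (x \in _).
have m_gt0 : 0 < m by apply: leq_trans le_16; rewrite muln_gt0.
have le_B : 2 * (K.+3 * (K.+3 * (K.+3 * B))) <= m.
  apply: leq_trans le_m; rewrite /B (expnS K.+3 2) (expnS K.+3 1) expn1.
  by move: (h ^ 3) (D ^ K.+1) K.+3 => x y z; lia.
have le_B' : K.+3 * (K.+3 * (K * B)) <= K.+3 * (K.+3 * (K.+3 * B)).
  by do 3 ![apply: leq_mul => //]; rewrite -addn3 leq_addr.
(* The three shares are at most [m / 16], [6 * m / 16] (from [h = 16 * K.+3]) and [m / 2], which add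
   up to less than [m]. *)
exfalso; move: cover sumM sum_stag (leq_trans sumA le_B') le_B; rewrite !big_split /=.
set S1 := \sum_(x < m) _; set S2 := \sum_(x < m) _; set S3 := \sum_(x < m) _.
by set S4 := K.+3 * _; clearbody S1 S2 S3 S4 M; clear -m_gt0 le_16; lia.
Qed.

End Family.

(** * Reduction from balanced words to boolean words *)

Lemma common_two_letters (T : eqType) (c0 c1 : T) (w w' : seq T) l :
    let bits v := [seq x == c1 | x <- v & (x == c0) || (x == c1)] in
  common (bits w) (bits w') l -> common w w' l.
Proof.
move=> bits [s [sw sw' le_l]]; pose letter (b : bool) := if b then c1 else c0.
have sub v : subseq s (bits v) -> subseq (map letter s) v.
  move=> /(map_subseq letter) sv; apply: subseq_trans sv _.
  rewrite -map_comp map_id_in ?filter_subseq // => x.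
  by rewrite mem_filter => /andP[/orP[]/eqP-> _] /=; rewrite /letter ?eqxx //; case: eqP.
by exists (map letter s); rewrite size_map !sub.
Qed.

Lemma count_two_letters (T : eqType) (c0 c1 : T) (w : seq T) : c0 != c1 ->
    let bits v := [seq x == c1 | x <- v & (x == c0) || (x == c1)] in
  count_mem true (bits w) = count_mem c1 w /\ count_mem false (bits w) = count_mem c0 w.
Proof.
move=> neq bits; rewrite !count_map !count_filter; split; apply: eq_count => x /=.
  by case: (x == c1); rewrite ?orbT ?andbF.
by case: (eqVneq x c1) => [->|_] /=; rewrite ?orbF // eq_sym (negbTE neq).
Qed.

Lemma sum_count_mem (T : finType) (w : seq T) : \sum_i count_mem i w = size w.
Proof.
elim: w => [|a w IHw] /=; first by rewrite big1.
by rewrite big_split /= IHw (bigD1 a) //= eqxx big1 // => i; rewrite eq_sym => /negbTE->.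
Qed.

Lemma balanced_count k n (w : n.-tuple 'I_k) i :
  0 < k -> balanced w -> count_mem i w = n %/ k.
Proof.
move=> k_gt0 /forallP/(_ i)/forallP w_bal.
have : \sum_j count_mem j w = n by rewrite sum_count_mem size_tuple.
rewrite (eq_bigr (fun=> count_mem i w)) => [|j _]; last by rewrite -(eqP (w_bal j)).
by rewrite sum_nat_const card_ord => def_n; rewrite -[in RHS]def_n mulKn.
Qed.

Lemma common_lcs (T : finType) (w w' : seq T) l : common w w' l -> l <= lcs w w'.
Proof.
move=> [s [sw sw' le_l]]; apply: leq_trans le_l _.
have lt_s : size s < (size w).+1 by rewrite ltnS size_subseq.
apply: (@leq_bigmax_cond _ _ _ (Ordinal lt_s)) => /=.
by apply/existsP; exists (in_tuple s); rewrite /= sw sw'.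
Qed.

(** The hypothesis [l <= n] covers the default value [n] of the iterated minimum; symmetry of
    [common] allows any pair [i != j]. *)
Lemma common_min_lcs (T : finType) t n (F : {set n.-tuple T}) l :
    l <= n ->
    (forall W : 'I_t -> n.-tuple T, (forall i, W i \in F) ->
       exists i j, i != j /\ common (W i) (W j) l) ->
  l <= min_lcs t F.
Proof.
move=> le_ln common_l; rewrite /min_lcs; elim/big_ind: _ => // [x y lx ly|W /ffun_onP WF].
  by rewrite leq_min lx ly.
have [i [j [neq_ij comm_ij]]] := common_l W WF.
have {neq_ij} [i' [j' [lt_ij comm]]] : exists i j : 'I_t, i < j /\ common (W i) (W j) l.
  have [lt_ij|lt_ji|eq_ij] := ltngtP i j; first by exists i, j.
    by exists j, i; split=> //; apply: commonC.
  by rewrite (val_inj eq_ij) eqxx in neq_ij.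
apply: leq_trans (common_lcs comm) _; rewrite /lcs_family.
by apply: (bigmax_sup i') => //; apply: (bigmax_sup j').
Qed.

Lemma min_lcs_binary t k n g :
    1 < k -> k %| n -> n %/ k + g <= n ->
    (forall u : 'I_t -> seq bool,
       (forall i, count_mem false (u i) = n %/ k) ->
       (forall i, count_mem true (u i) = n %/ k) ->
       exists i j, i != j /\ common (u i) (u j) (n %/ k + g)) ->
  n %/ k + g <= min_lcs t (balanced_words k n).
Proof.
move=> k_gt1 k_dvd le_n binary; apply: common_min_lcs => // W W_bal.
have k_gt0 := ltnW k_gt1; pose c0 := Ordinal k_gt0; pose c1 := Ordinal k_gt1.
have cnt i := @count_two_letters _ c0 c1 (W i) isT.
have [||i [j [neq_ij /common_two_letters comm]]] :=
    binary (fun i => [seq x == c1 | x <- W i & (x == c0) || (x == c1)]).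
- by move=> i; rewrite (proj2 (cnt i)) balanced_count //; have := W_bal i; rewrite inE.
- by move=> i; rewrite (proj1 (cnt i)) balanced_count //; have := W_bal i; rewrite inE.
by exists i, j.
Qed.

(** * The case [r = 1] *)

(** Two of the three words start with the same letter: two initial ones are the high case at
    [x = 0], two initial zeros the low case. *)
Lemma common_three (u : 'I_3 -> seq bool) m :
    0 < m -> (forall i, count_mem false (u i) = m) ->
    (forall i, count_mem true (u i) = m) ->
  exists i j, i != j /\ common (u i) (u j) (m + 1).
Proof.
move=> m_gt0 um tm.
have same (i j : 'I_3) : (ones_before (u i) 0 == 0) = (ones_before (u j) 0 == 0) ->
    common (u i) (u j) (m + 1).
  have [iz|i_gt0] := posnP (ones_before (u i) 0).
    move=> /esym/eqP jz.
    by apply: (@common_low (u i) (u j) m 0 1); rewrite ?iz ?jz.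
  rewrite eqn0Ngt => /esym/negbFE j_gt0.
  by apply: (@common_high (u i) (u j) m 0 1).
pose z i := ones_before (u i) 0 == 0.
have i1 : 1 < 3 by []. have i2 : 2 < 3 by [].
have [e01|n01] := eqVneq (z ord0) (z (Ordinal i1)).
  by exists ord0, (Ordinal i1); split; [|exact: same].
have [e02|n02] := eqVneq (z ord0) (z (Ordinal i2)).
  by exists ord0, (Ordinal i2); split; [|exact: same].
exists (Ordinal i1), (Ordinal i2); split; [by []|apply: same].
by move: n01 n02; rewrite /z; do 3 case: (_ == 0).
Qed.

(** * Choice of the base [D] and numerical bounds *)

(** This is [(1 + 1/d)^j <= 1 + j/d + (j/d)^2], cleared of denominators; the inductive step uses
    [j^2 <= j * d]. *)
Lemma succ_exp_le d j : j <= d -> d ^ 2 * d.+1 ^ j <= d ^ j * (d ^ 2 + j * d + j ^ 2).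
Proof.
elim: j => [|j IHj] lt_j; first by rewrite !expn0 mul0n !addn0 muln1 mul1n.
rewrite (expnSr d.+1 j) mulnA (expnSr d j).
apply: leq_trans (leq_mul (IHj (ltnW lt_j)) (leqnn _)) _.
rewrite -!mulnA leq_mul2l; apply/orP; right.
have : j * j * 1 <= j * d by rewrite muln1 leq_mul2l ltnW ?orbT.
by rewrite !expnS !expn0; nia.
Qed.

Lemma succ_exp_le3 d j : 0 < d -> j <= d -> d.+1 ^ j <= 3 * d ^ j.
Proof.
move=> d_gt0 le_jd; rewrite -(leq_pmul2l (_ : 0 < d ^ 2)) ?expn_gt0 ?d_gt0 //.
apply: leq_trans (succ_exp_le le_jd) _.
rewrite [leqRHS]mulnA [leqRHS]mulnC leq_mul2l; apply/orP; right.
have : j * d <= d * d by rewrite leq_mul2r le_jd orbT.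
have : j * j <= d * d by rewrite leq_mul.
by rewrite !expnS !expn0; lia.
Qed.

(* The base D of the scales is the largest multiple of 16 * (r + 2) with
   scale_const r * D ^ r <= m. *)
Definition scale_const (r : nat) := 36 * 1000 * r.+2 ^ 3 * (16 * r.+2) ^ 3.

Lemma scale_const_gt0 r : 0 < scale_const r.
Proof. by rewrite /scale_const !muln_gt0. Qed.

Lemma scale_const_le r : 1 < r -> scale_const r <= 10 ^ 12 * r ^ 6.
Proof.
move=> r_gt1; have le_q : r.+2 <= 2 * r by lia.
have le_h : 16 * r.+2 <= 10 ^ 2 * r by lia.
rewrite /scale_const.
have c1 : 36 * 1000 <= 10 ^ 5 by rewrite (expnD 10 2 3) leq_mul.
have c2 : r.+2 ^ 3 <= 10 * r ^ 3.
  apply: (@leq_trans ((2 * r) ^ 3)); first by rewrite leq_exp2r.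
  by rewrite expnMn leq_mul2r orbC.
have c3 : (16 * r.+2) ^ 3 <= 10 ^ 6 * r ^ 3.
  by rewrite (expnM 10 2 3) -expnMn leq_exp2r.
apply: leq_trans (leq_mul (leq_mul c1 c2) c3) _.
rewrite (expnD r 3 3) (expnD 10 6 6) (expnSr 10 5).
by move: (10 ^ 5) (10 ^ 6) (r ^ 3) => a b c; apply: eq_leq; lia.
Qed.

(** The multiplier [r] is admissible: [2 * scale_const r <= 10^13 * r^6 <= (10^7 * r^3)^r] because
    [r >= 2], and the other factor is at most [(10^2 * r^2)^r]. *)
Lemma scale_start r m : 1 < r -> (10 * r) ^ (9 * r) <= 2 * m ->
  scale_const r * (16 * r.+2 * r) ^ r <= m.
Proof.
move=> r_gt1 le_m; rewrite -(leq_pmul2l (ltn0Sn 1)); apply: leq_trans le_m.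
have r_gt0 := ltnW r_gt1.
have d1 : (16 * r.+2 * r) ^ r <= (10 ^ 2 * r ^ 2) ^ r.
  rewrite leq_exp2r // (expnS r 1) expn1 mulnA leq_mul2r; lia.
have d2 : 2 * scale_const r <= 10 ^ 13 * r ^ 6.
  by rewrite (expnS 10 12) -[leqRHS]mulnA leq_mul // scale_const_le.
have d3 : 10 ^ 13 * r ^ 6 <= (10 ^ 7 * r ^ 3) ^ r.
  have d3_base t : 0 < t -> t ^ 13 * r ^ 6 <= (t ^ 7 * r ^ 3) ^ r.
    move=> t_gt0; apply: (@leq_trans ((t ^ 7 * r ^ 3) ^ 2)); last first.
      by rewrite leq_pexp2l // muln_gt0 !expn_gt0 r_gt0 t_gt0.
    by rewrite expnMn -!expnM; apply: leq_mul; apply: leq_pexp2l.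
  exact: d3_base.
rewrite mulnA; apply: leq_trans (leq_mul (leq_trans d2 d3) d1) _.
rewrite -expnMn expnM leq_exp2r // (expnMn 10 r 9).
have le9 t : t ^ 7 * r ^ 3 * (t ^ 2 * r ^ 2) <= t ^ 9 * r ^ 9.
  by rewrite mulnACA -!expnD leq_mul2l leq_pexp2l ?orbT.
exact: le9.
Qed.

(** The largest admissible multiplier [d] is at least [r] by [scale_start], so replacing [d] by
    [d.+1], which is inadmissible, multiplies the [r]-th power by at most 3. *)
Lemma scale_exists r m : 1 < r -> (10 * r) ^ (9 * r) <= 2 * m ->
  exists2 D, 16 * r.+2 %| D & 1 < D /\
    scale_const r * D ^ r <= m < 3 * scale_const r * D ^ r.
Proof.
move=> r_gt1 le_m; have r_gt0 := ltnW r_gt1.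
have c_gt0 := scale_const_gt0 r.
pose P d := scale_const r * (16 * r.+2 * d) ^ r <= m.
have P_bound d : P d -> d <= m.
  apply: leq_trans; apply: leq_trans (leq_pmull _ c_gt0).
  case: d => // d; apply: (@leq_trans ((16 * r.+2 * d.+1) ^ 1)).
    by rewrite expn1 leq_pmull.
  by rewrite leq_pexp2l.
have exP : exists d, P d by exists r; apply: scale_start.
case: (ex_maxnP exP P_bound) => d Pd d_max.
have le_rd : r <= d by apply: d_max; apply: scale_start.
exists (16 * r.+2 * d); first exact: dvdn_mulr.
split; first by lia.
apply/andP; split; first exact: Pd.
have lt_m : m < scale_const r * (16 * r.+2 * d.+1) ^ r.
  by rewrite ltnNge; apply/negP => /d_max; rewrite ltnn.
apply: leq_trans lt_m _; rewrite [3 * _]mulnC -[leqRHS]mulnA leq_mul2l; apply/orP; right.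
rewrite (expnMn _ d.+1) (expnMn _ d) [leqRHS]mulnCA leq_mul2l; apply/orP; right.
by apply: succ_exp_le3; lia.
Qed.

Lemma min_lcs_gain r k n :
    1 < r -> 1 < k -> k %| n -> (10 * r) ^ (9 * r) <= 2 * (n %/ k) ->
  exists D g, [/\ n %/ k + g <= min_lcs r.+2 (balanced_words k n),
    16 * r.+2 * g = D ^ r.-1 & n %/ k <= 3 * scale_const r * D ^ r].
Proof.
case: r => // K r_gt1 k_gt1 k_dvd le_m.
have [D h_dvd [D_gt1 /andP[le_D /ltnW D_le]]] := scale_exists r_gt1 le_m.
(* The division is exact, since [16 * K.+3] divides [D] and [K > 0]. *)
have def_M : 16 * K.+3 * (D ^ K %/ (16 * K.+3)) = D ^ K.
  by rewrite mulnC divnK // dvdn_exp // -ltnS.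
exists D, (D ^ K %/ (16 * K.+3)); split=> //.
apply: min_lcs_binary => // [|u um tm].
  have le_g : D ^ K %/ (16 * K.+3) <= n %/ k.
    apply: leq_trans (leq_div _ _) _; apply: leq_trans le_D.
    apply: (@leq_trans (D ^ K.+1)); first by rewrite leq_exp2l.
    by rewrite leq_pmull // scale_const_gt0.
  apply: (@leq_trans (n %/ k * 2)); first by rewrite muln2 -addnn leq_add2l.
  by rewrite -[leqRHS](divnK k_dvd) leq_mul2l k_gt1 orbT.
by apply: (@common_family K (16 * K.+3) D) => //.
Qed.

Lemma scale_total_le r :
  1 < r -> 3 * scale_const r * (16 * r.+2) <= 10 ^ 15 * r ^ 9.
Proof.
move=> r_gt1; have le_h : 16 * r.+2 <= 10 ^ 2 * r by lia.
have le3 : 3 <= 10 by [].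
apply: leq_trans (leq_mul (leq_mul le3 (scale_const_le r_gt1)) le_h) _.
have le15 t : t * (t ^ 12 * r ^ 6) * (t ^ 2 * r) <= t ^ 15 * r ^ 9.
  rewrite [t * (_ * _)]mulnA -expnS mulnACA -expnD -expnSr leq_mul2l leq_pexp2l ?orbT //.
  exact: ltnW.
exact: le15.
Qed.

(** * Real powers and the final bound *)

Import Order.TTheory GRing.Theory Num.Theory.
Local Open Scope ring_scope.

(** With [a = 1 - 1/r], the power [(c * D^r)^a] splits into [c^a <= c], since [a <= 1 <= c], and
    [D^(r * a) = D^(r - 1)]. *)
Lemma powR_gain (R : realType) (m r c D : nat) :
    (0 < r)%N -> (0 < c)%N -> (m <= c * D ^ r)%N ->
  m%:R `^ (1 - r%:R^-1) <= (c * D ^ r.-1)%:R :> R.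
Proof.
move=> r_gt0 c_gt0 le_m; set a := 1 - _.
have r_neq0 : r%:R != 0 :> R by rewrite pnatr_eq0 -lt0n.
have a_ge0 : 0 <= a by rewrite subr_ge0 invf_le1 ?ltr0n ?ler1n.
have a_le1 : a <= 1 by rewrite gerBl invr_ge0 ler0n.
apply: (@le_trans _ _ ((c * D ^ r)%:R `^ a)).
  by rewrite ge0_ler_powR ?nnegrE ?ler0n ?ler_nat.
rewrite !natrM powRM ?ler0n // ler_pM ?powR_ge0 //.
  by rewrite -[leRHS]powRr1 ?ler0n // ler_powR // ler1n.
rewrite natrX -powR_mulrn ?ler0n // -powRrM natrX -powR_mulrn ?ler0n //.
by rewrite mulrBr mulr1 divff // -[X in _ - X]/(1%:R) -natrB // subn1.
Qed.

Theorem theorem2 (R : realType) :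
  exists C1 C2 : R, 0 < C1 /\ C1 <= C2 /\
    forall k r n : nat,
      (2 <= k)%N -> (1 <= r)%N ->
      k%:R * (10 * r%:R) ^+ (9 * r) / 2 <= n%:R :> R ->
      (k %| n)%N ->
      exists c' : R,
        C1 * r%:R ^- 9 * k%:R `^ (r%:R^-1 - 1) <= c' /\
        c' <= C2 * r%:R ^- 9 * k%:R `^ (r%:R^-1 - 1) /\
        n%:R / k%:R + c' * n%:R `^ (1 - r%:R^-1)
          <= (min_lcs r.+2 (balanced_words k n))%:R.
Proof.
(* The value comes from [scale_total_le]; both constants are [C], and [c'] is the common bound
   itself. *)
pose C : R := (10 ^+ 15)^-1.
exists C, C; split; first by rewrite invr_gt0 exprn_gt0 // ltr0n.
split=> // k r n k_gt1 r_gt0 le_n k_dvd.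
exists (C * r%:R ^- 9 * k%:R `^ (r%:R^-1 - 1)); do 2!split=> //.
have k_gt0 : (0 < k)%N := ltnW k_gt1.
have [m def_n] : exists m, n = (m * k)%N by exists (n %/ k)%N; rewrite divnK.
have k_neq0 : k%:R != 0 :> R by rewrite pnatr_eq0 -lt0n.
have def_m : (n %/ k = m)%N by rewrite def_n mulnK.
have le_m : ((10 * r) ^ (9 * r) <= 2 * m)%N.
  rewrite -(ler_nat R) -(@ler_pM2l _ k%:R) ?ltr0n // natrX !natrM.
  move: le_n; rewrite ler_pdivrMr ?ltr0n // def_n natrM.
  by rewrite [leRHS]mulrAC [leRHS]mulrC [m%:R * _]mulrC.
have m_gt0 : (0 < m)%N.
  rewrite -(ltn_pmul2l (ltn0Sn 1)) muln0 (leq_trans _ le_m) //.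
  by rewrite expn_gt0 muln_gt0 r_gt0.
have -> : n%:R / k%:R = m%:R :> R by rewrite def_n natrM mulfK.
(* With [n = m * k], the powers of [k] have opposite exponents and cancel. *)
have -> : C * r%:R ^- 9 * k%:R `^ (r%:R^-1 - 1) * n%:R `^ (1 - r%:R^-1) =
    C * r%:R ^- 9 * m%:R `^ (1 - r%:R^-1).
  rewrite -mulrA; congr (_ * _); rewrite def_n natrM powRM ?ler0n // mulrCA.
  rewrite -powRD ?k_neq0 ?implybT //.
  by rewrite addrA subrK subrr powRr0 mulr1.
(* For [r = 1] the exponent of [n] is 0 and [C <= 1], so one extra letter suffices. *)
have [r1|r_neq1] := eqVneq r 1%N.
  rewrite r1 expr1n invr1 subrr powRr0 !mulr1.
  apply: (@le_trans _ _ (m + 1)%:R).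
    by rewrite natrD lerD2l invf_le1 ?exprn_gt0 ?exprn_ege1 ?ltr0n ?ler1n.
  rewrite ler_nat -def_m; apply: min_lcs_binary => // [|u um tm].
    rewrite def_m def_n; apply: (@leq_trans (m * 2)); last by rewrite leq_mul2l k_gt1 orbT.
    by rewrite muln2 -addnn leq_add2l.
  by apply: common_three => //; rewrite def_m.
have r_gt1 : (1 < r)%N by rewrite ltn_neqAle eq_sym r_neq1.
have [|D [g [le_lcs def_M]]] := min_lcs_gain r_gt1 k_gt1 k_dvd; first by rewrite def_m.
rewrite def_m => le_D.
apply: (@le_trans _ _ (m + g)%:R); last by rewrite ler_nat -def_m.
rewrite natrD lerD2l.
have c_gt0 : (0 < 3 * scale_const r)%N by rewrite muln_gt0 scale_const_gt0.
have := powR_gain R r_gt0 c_gt0 le_D.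
(* Writing [D ^ r.-1] as [16 * r.+2 * g] turns the power bound into a multiple of [g], whose factor
   is at most [10^15 * r^9]. *)
rewrite -def_M mulnA natrM => le_pow.
have le_tot : (3 * scale_const r * (16 * r.+2))%:R <= 10 ^+ 15 * r%:R ^+ 9 :> R.
  by have := scale_total_le r_gt1; rewrite -(ler_nat R) [leRHS]natrM !natrX.
rewrite /C -invfM ler_pdivrMl ?mulr_gt0 ?exprn_gt0 ?ltr0n //.
by apply: le_trans le_pow _; rewrite ler_wpM2r ?ler0n.
Qed.
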